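(* Let $n\ge 1$ and $b\ge 2$ be integers, and let $w$ be a nonempty word over an $n$-letter alphabet. In the one-dimensional setting with $b$-letter replacement rules, $$F_1(b,n,w)\le \mathcal{W}_1(b,n,|w|).$$ That is, for every choice of $b$-letter replacement rules and every starting level $L_1$, if $w$ appears on some level, then it appears on some level $L_k$ with $k\le \mathcal{W}_1(b,n,|w|)$.
   Context: Fix an alphabet with $n$ letters. A word is a nonempty finite string of letters; $|w|$ is the length of $w$. One-dimensional setting: a replacement rule assigns to each letter $a$ a string $R(a)$ of exactly $b$ letters; $R$ extends to strings by concatenation, $R(a_1\cdots a_m)=R(a_1)\cdots R(a_m)$. The first level $L_1$ is any nonempty string of letters and $L_{k+1}=R(L_k)$ for $k\ge 1$. A word $w$ appears on $L_k$ if it occurs in $L_k$ as a block of consecutive letters, read from left to right; it appears for the first time on $L_k$ if $k$ is the least index such that $w$ appears on $L_k$. $F_1(b,n,w)$ denotes the latest level on which $w$ can appear for the first time, i.e. the supremum, over all choices of replacement rules and all $L_1$ for which $w$ appears on at least one level, of the index of the level on which $w$ appears for the first time. The function $\mathcal{W}_1$ is defined by $$\mathcal{W}_1(b,n,|w|)=\begin{cases} n & |w|=1,\\ \lceil \log_b(b|w|-b)\rceil+n^2 & |w|>1.\end{cases}$$ *)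

(* Defs.v *)
From mathcomp Require Import all_boot all_order all_algebra.
From mathcomp Require Import all_classical all_reals all_analysis.

Set Implicit Arguments.
Unset Strict Implicit.
Unset Printing Implicit Defensive.

Import Order.TTheory GRing.Theory Num.Theory.

Local Open Scope classical_set_scope.
Local Open Scope ring_scope.

Definition replace (A : finType) (b : nat) (rule : A -> b.-tuple A)
    (s : seq A) : seq A :=
  flatten [seq tval (rule a) | a <- s].

(* Levels are numbered from 1; the junk index 0 also denotes L1, and is
   excluded in [first_appears_on]. *)
Definition level (A : finType) (b : nat) (rule : A -> b.-tuple A)
    (L1 : seq A) (k : nat) : seq A :=
  iter k.-1 (replace rule) L1.

Definition appears_on (A : finType) (b : nat) (rule : A -> b.-tuple A)
    (L1 w : seq A) (k : nat) : bool :=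
  infix w (level rule L1 k).

Definition first_appears_on (A : finType) (b : nat) (rule : A -> b.-tuple A)
    (L1 w : seq A) (k : nat) : Prop :=
  [/\ (1 <= k)%N, appears_on rule L1 w k &
      forall j, (1 <= j < k)%N -> ~~ appears_on rule L1 w j].

(* The number of letters is #|A|.  The supremum is taken in the extended
   reals, so it is meaningful without knowing that it is finite. *)
Definition F1 (R : realType) (A : finType) (b : nat) (w : seq A) : \bar R :=
  ereal_sup [set (k%:R)%:E | k in
    [set k : nat | exists (rule : A -> b.-tuple A) (L1 : seq A),
       L1 != [::] /\ first_appears_on rule L1 w k]].

Definition logb (R : realType) (b x : R) : R := ln x / ln b.

(* [l] is the length of a word; the value at l = 0 is irrelevant. *)
Definition W1 (R : realType) (b n l : nat) : int :=
  if l == 1%N then n%:Z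
  else Num.ceil (logb (b%:R : R) (b%:R * l%:R - b%:R)) + (n ^ 2)%N%:Z.

(* Main.v *)
Require Import Defs.
From mathcomp Require Import all_boot all_order all_algebra.
From mathcomp Require Import all_classical all_reals all_analysis.
From mathcomp Require Import zify.
Import Order.TTheory GRing.Theory Num.Theory.

(** A block of consecutive letters of level [k + 1] is produced by a block of
    level [k], its ancestor.  If the word first appears on level [k + 1], its
    ancestor first appears on level [k], since an earlier occurrence of the
    ancestor would produce an earlier occurrence of the word.  A word of
    length at most [b * d + 1] meets at most [d + 1] of the replaced blocks,
    so an ancestor of length at most [d + 1] can be chosen
    ([first_appears_on_parent]).

    Two consequences give the bound.  Since [d <= b * d], the ancestor of a
    word of length [d + 1] can be taken of length [d + 1] again, as long as the
    levels are long enough to contain such a word.  Hence each level below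
    introduces a new word of length [d + 1]; these words are pairwise distinct
    and there are [n ^ (d + 1)] words of that length
    ([first_appearance_bound]).  On the other hand, a word of length at most
    [b ^ t + 1] has an ancestor of length at most 2 after [t] steps back
    ([first_appears_on_ancestor]).

    For a single letter, counting with [d = 0] gives the bound [n].  For a
    longer word, one goes back [t] steps to an ancestor of length at most 2,
    where [b ^ t >= |w| - 1], and counts pairs of letters.  The pairs are
    counted from level 2 on only, because level 1 may consist of one letter:
    hence the bound [t + 1 + n ^ 2], and [t + 1] is the ceiling of
    [log_b (b |w| - b)]. *)

(** * Replacement and blocks of consecutive letters *)

Lemma replace_cat {A : finType} {b : nat} (rule : A -> b.-tuple A)
    (s1 s2 : seq A) :
  replace rule (s1 ++ s2) = replace rule s1 ++ replace rule s2.
Proof. by rewrite /replace map_cat flatten_cat. Qed.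

Lemma size_replace {A : finType} {b : nat} (rule : A -> b.-tuple A)
    (s : seq A) : size (replace rule s) = b * size s.
Proof.
elim: s => [|a s IH]; first by rewrite muln0.
by rewrite /replace /= size_cat size_tuple -/(replace rule s) IH mulnS.
Qed.

Lemma infix_replace {A : finType} {b : nat} (rule : A -> b.-tuple A)
    (s1 s2 : seq A) : infix s1 s2 -> infix (replace rule s1) (replace rule s2).
Proof.
move=> /infixP[x [y ->]]; apply/infixP.
by exists (replace rule x), (replace rule y); rewrite !replace_cat.
Qed.

Lemma drop_replace {A : finType} {b : nat} (rule : A -> b.-tuple A)
    (q : nat) (s : seq A) :
  drop (b * q) (replace rule s) = replace rule (drop q s).
Proof.
have [le_qs|/ltnW le_sq] := leqP q (size s); last first.
  by rewrite !drop_oversize // size_replace leq_mul2l le_sq orbT.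
rewrite -{1}(cat_take_drop q s) replace_cat drop_size_cat //.
by rewrite size_replace size_takel.
Qed.

Lemma take_replace {A : finType} {b : nat} (rule : A -> b.-tuple A)
    (q : nat) (s : seq A) :
  take (b * q) (replace rule s) = replace rule (take q s).
Proof.
have [le_qs|/ltnW le_sq] := leqP q (size s); last first.
  by rewrite !take_oversize // size_replace leq_mul2l le_sq orbT.
rewrite -{1}(cat_take_drop q s) replace_cat take_size_cat //.
by rewrite size_replace size_takel.
Qed.

Lemma infix_take_drop {T : eqType} (m p : nat) (s : seq T) :
  infix (take m (drop p s)) s.
Proof. exact: (infix_trans (infix_take _ _) (infix_drop _ _)). Qed.

Lemma infix_extend {T : eqType} (m : nat) (u s : seq T) :
    size u <= m <= size s -> infix u s ->
  exists u', [/\ size u' = m, infix u u' & infix u' s].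
Proof.
move=> /andP[le_um le_ms]; rewrite infixE; move: (infix_index _ _) => p /eqP<-.
(* The window of length m starts at p, or ends with s if p is too far right. *)
exists (take m (drop (minn p (size s - m)) s)); split.
- by rewrite size_takel // size_drop; lia.
- have [le_p|/ltnW le_p] := leqP p (size s - m).
    by rewrite -(take_takel _ le_um) infix_take.
  rewrite [take m _]take_oversize ?size_drop; last by lia.
  by rewrite -{1}(subnK le_p) -drop_drop infix_take_drop.
- exact: infix_take_drop.
Qed.

(** The block starts inside the replacement of the letter of index [q = p %/ b],
    at an offset of at most [b - 1], so it ends within the replacements of the
    [d + 1] letters that start at [q]. *)
Lemma infix_replace_inv {A : finType} {b : nat} (rule : A -> b.-tuple A)
    (d : nat) (u s : seq A) :
    0 < b -> size u <= b * d + 1 -> infix u (replace rule s) ->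
  exists v, [/\ size v <= d.+1, infix v s & infix u (replace rule v)].
Proof.
move=> b_gt0 le_u; rewrite infixE; move: (infix_index _ _) => p /eqP def_u.
exists (take d.+1 (drop (p %/ b) s)); split.
- by rewrite size_take; case: ltnP.
- exact: infix_take_drop.
rewrite -take_replace -drop_replace -def_u {1}(divn_eq p b).
rewrite addnC [_ * b]mulnC -drop_drop take_drop.
have le_end : size u + p %% b <= b * d.+1.
  by have := ltn_pmod p b_gt0; rewrite mulnS; lia.
rewrite -(take_takel _ le_end).
exact: infix_trans (infix_drop _ _) (infix_take _ _).
Qed.

(** * Ancestors of a word that appears for the first time *)

Lemma levelS {A : finType} {b : nat} (rule : A -> b.-tuple A) (L1 : seq A)
    (k : nat) : 0 < k -> level rule L1 k.+1 = replace rule (level rule L1 k).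
Proof. by case: k. Qed.

Lemma size_level {A : finType} {b : nat} (rule : A -> b.-tuple A) (L1 : seq A)
    (k : nat) : size (level rule L1 k) = b ^ k.-1 * size L1.
Proof.
rewrite /level; elim: k.-1 => [|i IH] /=; first by rewrite mul1n.
by rewrite size_replace IH expnS mulnA.
Qed.

Lemma leq_size_level {A : finType} {b : nat} (rule : A -> b.-tuple A)
    (L1 : seq A) (m k : nat) :
  0 < b -> m <= k -> size (level rule L1 m) <= size (level rule L1 k).
Proof.
by move=> b_gt0 le_mk; rewrite !size_level leq_mul2r leq_pexp2l ?orbT //; lia.
Qed.

Lemma first_appears_on_superword {A : finType} {b : nat}
    (rule : A -> b.-tuple A) (L1 u u' : seq A) (k : nat) :
    infix u u' -> appears_on rule L1 u' k -> first_appears_on rule L1 u k ->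
  first_appears_on rule L1 u' k.
Proof.
move=> uu' u'k [k_gt0 _ u_new]; split=> // j /u_new.
by apply: contra; apply: infix_trans.
Qed.

Lemma first_appears_on_parent {A : finType} {b : nat}
    (rule : A -> b.-tuple A) (L1 : seq A) (d : nat) (u : seq A) (k : nat) :
    0 < b -> 0 < k -> size u <= b * d + 1 ->
    first_appears_on rule L1 u k.+1 ->
  exists2 v, size v <= d.+1 & first_appears_on rule L1 v k.
Proof.
move=> b_gt0 k_gt0 le_u [_ + u_new]; rewrite /appears_on levelS //.
move=> /(infix_replace_inv _ _ _ _ b_gt0 le_u)[v [le_v vk uv]].
exists v => //; split=> // j /andP[j_gt0 lt_jk].
apply: contra (u_new j.+1 _); last by rewrite ltnS.
rewrite /appears_on levelS // => vj.
exact: infix_trans uv (infix_replace _ _ _ vj).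
Qed.

Lemma first_appears_on_ancestor {A : finType} {b : nat}
    (rule : A -> b.-tuple A) (L1 : seq A) (d t j : nat) (u : seq A) :
    0 < b -> 0 < j -> size u <= b ^ t * d + 1 ->
    first_appears_on rule L1 u (t + j) ->
  exists2 v, size v <= d.+1 & first_appears_on rule L1 v j.
Proof.
move=> b_gt0 j_gt0; elim: t u => [|t IH] u le_u u_first.
  by exists u; rewrite // -addn1 -[d]mul1n.
have tj_gt0: 0 < t + j by rewrite addn_gt0 j_gt0 orbT.
move: le_u; rewrite expnS -mulnA => le_u.
have [v le_v] := first_appears_on_parent _ _ _ _ _ b_gt0 tj_gt0 le_u u_first.
by apply: IH; rewrite addn1.
Qed.

(** The parent of a word of length [d + 1] can be taken of length at most
    [d + 1] because [d <= b * d].  Extending it to length [d + 1] exactly keeps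
    it new, since a superword cannot appear before the word it contains. *)
Lemma first_appears_on_every_level {A : finType} {b : nat}
    (rule : A -> b.-tuple A) (L1 : seq A) (d m i k : nat) (u : seq A) :
    0 < b -> 0 < m -> d < size (level rule L1 m) -> m <= i <= k ->
    size u = d.+1 -> first_appears_on rule L1 u k ->
  exists v : d.+1.-tuple A, first_appears_on rule L1 v i.
Proof.
move=> b_gt0 m_gt0 lt_dm /andP[le_mi le_ik]; rewrite -(subnK le_ik).
elim: (k - i) u => [|e IH] u size_u u_first.
  by exists (tcast size_u (in_tuple u)); rewrite val_tcast.
have ei_gt0: 0 < e + i by lia.
have le_u: size u <= b * d + 1 by rewrite size_u addn1 ltnS leq_pmull.
have [v le_v v_first] :=
  first_appears_on_parent _ _ _ _ _ b_gt0 ei_gt0 le_u u_first.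
have [_ v_on _] := v_first.
have le_window: size v <= d.+1 <= size (level rule L1 (e + i)).
  rewrite le_v (leq_trans lt_dm) // leq_size_level //; lia.
have [v' [size_v' vv' v'_on]] := infix_extend _ _ _ le_window v_on.
exact: IH size_v' (first_appears_on_superword _ _ _ _ _ vv' v'_on v_first).
Qed.

Lemma first_appears_on_inj {A : finType} {b : nat} (rule : A -> b.-tuple A)
    (L1 u : seq A) (i j : nat) :
  first_appears_on rule L1 u i -> first_appears_on rule L1 u j -> i = j.
Proof.
move=> [i_gt0 ui i_new] [j_gt0 uj j_new]; case: (ltngtP i j) => // lt_ij.
- by have := j_new i; rewrite i_gt0 lt_ij ui => /(_ isT).
- by have := i_new j; rewrite j_gt0 lt_ij uj => /(_ isT).
Qed.

(** A new word chosen on each of the levels [m], ..., [k] determines its level,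
    so these [k + 1 - m] levels inject into the words of length [d + 1]. *)
Lemma first_appearance_bound {A : finType} {b : nat}
    (rule : A -> b.-tuple A) (L1 : seq A) (d m k : nat) (u : seq A) :
    0 < b -> 0 < m -> d < size (level rule L1 m) ->
    size u = d.+1 -> first_appears_on rule L1 u k ->
  k < m + #|A| ^ d.+1.
Proof.
move=> b_gt0 m_gt0 lt_dm size_u u_first.
have [lt_km|le_mk] := ltnP k m; first by apply: leq_trans lt_km (leq_addr _ _).
have new_word (i : 'I_(k.+1 - m)) :
    {v : d.+1.-tuple A | first_appears_on rule L1 v (m + i)}.
  apply: cid.
  apply: (first_appears_on_every_level _ _ _ m) size_u u_first => //.
  by have := ltn_ord i; lia.
have new_word_inj : injective (fun i => sval (new_word i)).
  move=> i j eq_ij; apply/val_inj/eqP; rewrite -(eqn_add2l m); apply/eqP.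
  have := svalP (new_word i); rewrite eq_ij => v_first.
  exact: first_appears_on_inj v_first (svalP (new_word j)).
have := leq_card _ new_word_inj.
by rewrite card_ord card_tuple leq_subLR.
Qed.

(** * The two cases of the bound *)

Lemma letter_first_appearance {A : finType} {b : nat}
    (rule : A -> b.-tuple A) (L1 w : seq A) (k : nat) :
    0 < b -> L1 != [::] -> size w = 1 -> first_appears_on rule L1 w k ->
  k <= #|A|.
Proof.
move=> b_gt0 L1_n0 size_w w_first.
have lt_01 : 0 < size (level rule L1 1) by rewrite /level /= lt0n size_eq0.
have := first_appearance_bound _ _ _ 1 _ _ b_gt0 isT lt_01 size_w w_first.
by rewrite expn1 add1n ltnS.
Qed.

Lemma word_first_appearance {A : finType} {b : nat}
    (rule : A -> b.-tuple A) (L1 w : seq A) (t k : nat) :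
    1 < b -> L1 != [::] -> size w <= b ^ t + 1 ->
    first_appears_on rule L1 w k ->
  k <= t.+1 + #|A| ^ 2.
Proof.
move=> b_gt1 L1_n0 le_w w_first; have b_gt0 := ltnW b_gt1.
have [le_kt|lt_tk] := leqP k t.+1; first exact: leq_trans le_kt (leq_addr _ _).
have j_gt0 : 0 < k - t by lia.
move: le_w w_first; rewrite -[b ^ t]muln1 -{1}(subnKC (ltnW (ltnW lt_tk))).
move=> le_w w_first.
have [v le_v v_first] :=
  first_appears_on_ancestor _ _ _ _ _ _ b_gt0 j_gt0 le_w w_first.
have lt_12 : 1 < size (level rule L1 2).
  by rewrite size_level expn1 (leq_trans b_gt1) // leq_pmulr // lt0n size_eq0.
have [_ v_on _] := v_first.
have le_window : size v <= 2 <= size (level rule L1 (k - t)).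
  rewrite le_v (leq_trans lt_12) // leq_size_level //; lia.
have [v' [size_v' vv' v'_on]] := infix_extend _ _ _ le_window v_on.
have v'_first := first_appears_on_superword _ _ _ _ _ vv' v'_on v_first.
have := first_appearance_bound _ _ _ 2 _ _ b_gt0 isT lt_12 size_v' v'_first.
by lia.
Qed.

Local Open Scope ring_scope.

(** The exponent [t] is one less than the ceiling of [log_b (b l - b)]; this is
    a natural number because [b l - b >= b]. *)
Lemma W1_word {R : realType} {b n l : nat} : (1 < b)%N -> (1 < l)%N ->
  exists2 t : nat, W1 R b n l = (t.+1 + n ^ 2)%N%:Z & (l <= b ^ t + 1)%N.
Proof.
move=> b_gt1 l_gt1; rewrite /W1 gtn_eqF //.
have b_gt0 : 0 < b%:R :> R by rewrite ltr0n ltnW.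
have lnb_gt0 : 0 < ln (b%:R : R) by rewrite ln_gt0 // ltr1n.
have -> : b%:R * l%:R - b%:R = (b * l.-1)%:R :> R.
  by rewrite -natrM -natrB; [congr _%:R|]; nia.
have x_gt0 : 0 < (b * l.-1)%:R :> R by rewrite ltr0n; nia.
set x := logb _ _.
have x_ge1 : 1 <= x.
  by rewrite /x /logb ler_pdivlMr // mul1r ler_ln ?posrE // ler_nat; nia.
have c_gt0 : 0 < Num.ceil x by rewrite ceil_gt0 (lt_le_trans ltr01).
have := ceil_ge x; case: (Num.ceil x) c_gt0 => // -[//|t] _ x_le.
exists t => //.
suff: (b * l.-1 <= b ^ t.+1)%N by rewrite expnS (leq_pmul2l (ltnW b_gt1)) addn1; case: (l).
have bt_gt0 : 0 < b%:R ^+ t.+1 :> R by rewrite exprn_gt0.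
rewrite -(ler_nat R) natrX -ler_ln ?posrE // lnXn //.
by rewrite -[ln _ *+ _]mulr_natl -ler_pdivrMr.
Qed.

Local Open Scope ereal_scope.

Theorem theorem5 (R : realType) (n b : nat) (hn : (1 <= n)%N) (hb : (2 <= b)%N)
    (A : finType) (hA : #|A| = n) (w : seq A) (hw : w != [::]) :
  F1 R b w <= ((W1 R b n (size w))%:~R)%:E.
Proof.
apply: ge_ereal_sup => _ [k [rule [L1 [L1_n0 w_first]]] <-].
rewrite lee_fin; have [size_w|size_w1] := eqVneq (size w) 1%N.
  rewrite /W1 size_w eqxx -hA ler_nat.
  exact: letter_first_appearance (ltnW hb) L1_n0 size_w w_first.
have size_w : (1 < size w)%N by rewrite ltn_neqAle eq_sym size_w1 lt0n size_eq0.
have [t -> le_w] := W1_word (R := R) (n := n) hb size_w.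
rewrite -hA ler_nat.
exact: word_first_appearance hb L1_n0 le_w w_first.
Qed.
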